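(* Let $0<a<b$ and $K_1>K_2>0$, let $I_1,\dots,I_N$ be a partition of $[0,a]$ and $I'_1,\dots,I'_N$ a partition of $[a,b]$. There exists a number $\beta''_c>0$ such that for every $\beta$ with $\beta''_c<\beta\le\infty$ the Max-Mixed system $$u=(K_1-K_2)\,u\sum_{k=1}^{N}\max_{x\in\overline{I}_k}f_\beta\big(\sqrt{u^2+x^2}\big)|\overline{I}_k|+K_2\,v\sum_{k=1}^{N}\max_{x\in\overline{I'}_k}f_\beta\big(\sqrt{v^2+x^2}\big)|\overline{I'}_k|,$$ $$v+K_2\,v\sum_{k=1}^{N}\min_{x\in\overline{I'}_k}f_\beta\big(\sqrt{v^2+x^2}\big)|\overline{I'}_k|=K_2\,u\sum_{k=1}^{N}\max_{x\in\overline{I}_k}f_\beta\big(\sqrt{u^2+x^2}\big)|\overline{I}_k|$$ has a nontrivial solution with $u>0$, $v>0$, while for every $\beta$ with $0<\beta<\beta''_c$ the only solution of this system is the trivial one, $u=0$, $v=0$.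
   Context: For $0<\beta<\infty$, $f_\beta(t)=\dfrac{\tanh(\beta t/2)}{t}$ for $t>0$ and $f_\beta(0)=\beta/2$; for $\beta=\infty$, $f_\infty(t)=1/t$ for $t>0$. A partition of a compact interval $J$ is a finite family of pairwise disjoint nonempty open subintervals of $J$ whose closures cover $J$; $|\overline{I}|$ denotes the length of the interval $\overline{I}$. A solution is a pair of real numbers $(u,v)$. *)

(* Defs.v *)
From HB Require Import structures.
From mathcomp Require Import all_boot all_order all_algebra.
From mathcomp Require Import all_classical all_reals all_analysis.
Import Order.TTheory GRing.Theory Num.Theory.
Import numFieldNormedType.Exports.
Set Implicit Arguments.
Unset Strict Implicit.
Unset Printing Implicit Defensive.
Local Open Scope classical_set_scope.
Local Open Scope ring_scope.

Definition tanh (R : realType) (t : R) : R :=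
  (expR t - expR (- t)) / (expR t + expR (- t)).

(* Meaningful for 0 < beta <= +oo and t >= 0, except beta = +oo with t = 0,
   where the value is the junk 0^-1 = 0. *)
Definition fbeta (R : realType) (beta : \bar R) (t : R) : R :=
  match beta with
  | b%:E => if t == 0 then b / 2 else tanh (b * t / 2) / t
  | +oo%E => t^-1
  | -oo%E => 0
  end.

(* Genuine maxima and minima, not suprema and infima: the value is an element
   of A bounding A, and the default 0 if there is none. *)
Definition setmax (R : realType) (A : set R) : R := xget 0 (A `&` ubound A).
Definition setmin (R : realType) (A : set R) : R := xget 0 (A `&` lbound A).

(* A nonempty bounded open interval is given by its endpoints p.1 < p.2;
   its closure is then clitv p, of length len p. *)
Definition opitv (R : realType) (p : R * R) : set R := `]p.1, p.2[.
Definition clitv (R : realType) (p : R * R) : set R := `[p.1, p.2].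
Definition len (R : realType) (p : R * R) : R := p.2 - p.1.

Definition is_partition (R : realType) (N : nat) (I : 'I_N -> R * R)
    (J : set R) : Prop :=
  [/\ forall k, (I k).1 < (I k).2,
      forall k, opitv (I k) `<=` J,
      forall j k, j != k -> opitv (I j) `&` opitv (I k) = set0
    & J `<=` [set x | exists k, clitv (I k) x]].

Definition maxsum (R : realType) (N : nat) (I : 'I_N -> R * R)
    (beta : \bar R) (w : R) : R :=
  \sum_(k < N)
    setmax [set fbeta beta (Num.sqrt (w ^+ 2 + x ^+ 2)) | x in clitv (I k)]
      * len (I k).

Definition minsum (R : realType) (N : nat) (I : 'I_N -> R * R)
    (beta : \bar R) (w : R) : R :=
  \sum_(k < N)
    setmin [set fbeta beta (Num.sqrt (w ^+ 2 + x ^+ 2)) | x in clitv (I k)]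
      * len (I k).

Definition max_mixed (R : realType) (N : nat) (K1 K2 : R)
    (I I' : 'I_N -> R * R) (beta : \bar R) (u v : R) : Prop :=
  u = (K1 - K2) * u * maxsum I beta u + K2 * v * maxsum I' beta v
  /\ v + K2 * v * minsum I' beta v = K2 * u * maxsum I beta u.

(* Main.v *)
Require Import Defs.
From mathcomp Require Import all_boot all_order all_algebra.
From mathcomp Require Import all_classical all_reals all_analysis.
From mathcomp Require Import ring lra.
Import Order.TTheory GRing.Theory Num.Theory.
Import numFieldNormedType.Exports.
Local Open Scope classical_set_scope.
Local Open Scope ring_scope.

(* Since [fbeta beta] decreases, the maxima and minima are attained at the left
   and right endpoints.  Write [A(u)], [B(v)], [C(v)] for the max-sum on
   [0, a], the max-sum and the min-sum on [a, b].  For [u != 0] the system says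
   [v / u = K2 A / (1 + K2 C)] and [G(u, v) = 1] with
   [G = A ((K1 - K2) + K2^2 B / (1 + K2 C))].  The critical [beta] is the one
   where [G(0, 0)] crosses [1].

   - [G(0, 0)] increases with [beta]: [d (ln (fbeta beta t)) / d (ln beta)] is
     [y / sinh y] at [y = beta t], which decreases in [t], so [A] grows
     relatively faster than [C].
   - At a solution with [u != 0], [G(u, v) < G(0, 0)].  Indeed [fbeta beta] is
     log-convex as a function of [t^2].  If [K2 B <= 1 + K2 C], this makes
     [B / (1 + K2 C)] at most its value at [0]; otherwise [G = 1] forces
     [|v| <= |u|], and then it makes [A / (1 + K2 C)] at most its value at [0].
   - If [G(0, 0) > 1], or [beta = +oo], the intermediate value theorem gives a
     positive solution. *)

(** * Hyperbolic functions *)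

(** Differentiability is asked only beyond [m] and continuity from [m] on: with [m = 0] this covers
    functions whose derivative formula divides by the variable. *)
Lemma le_ge0_derive {R : realType} (f df : R -> R) (m x y : R) :
  (forall z : R, m < z -> is_derive z 1 f (df z)) ->
  (forall z, m < z -> 0 <= df z) ->
  (forall z, m <= z -> {for z, continuous f}) ->
  m <= x -> x <= y -> f x <= f y.
Proof.
move=> f_df df_ge0 f_cont mx xy.
apply: (@ger0_derive1_le_cc R f m y) => //.
- by move=> z /[!in_itv]/= /andP[mz _]; have := f_df _ mz; case.
- move=> z /[!in_itv]/= /andP[mz _].
  by have /@derive_val dE := f_df _ mz; rewrite derive1E dE df_ge0.
- apply: continuous_in_subspaceT => z.
  by rewrite inE/= in_itv/= => /andP[mz _]; exact: f_cont.
- by rewrite in_itv/= mx xy.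
- by rewrite in_itv/= lexx (le_trans mx xy).
Qed.

Lemma is_derive_continuous {R : realType} (f : R -> R) (x df : R) :
  is_derive x 1 f df -> {for x, continuous f}.
Proof. by case=> /derivable1_diffP/differentiable_continuous. Qed.

Lemma ge0_of_derive {R : realType} (f df : R -> R) (x : R) :
  (forall z : R, is_derive z 1 f (df z)) -> f 0 = 0 ->
  (forall z, 0 <= z -> 0 <= df z) -> 0 <= x -> 0 <= f x.
Proof.
move=> f_df f0 df_ge0 x0; rewrite -f0.
apply: (@le_ge0_derive _ f df 0) => // z z0; first exact/df_ge0/ltW.
exact: is_derive_continuous (f_df z).
Qed.

Lemma ge_le0_derive {R : realType} (f df : R -> R) (x y : R) :
  (forall z : R, 0 < z -> is_derive z 1 f (df z)) ->
  (forall z, 0 < z -> df z <= 0) ->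
  0 < x -> x <= y -> f y <= f x.
Proof.
move=> f_df df_le0 x0 xy; rewrite -lerN2.
apply: (@le_ge0_derive _ (fun z => - f z) (fun z => - df z) x) => // z xz.
- have ? := f_df _ (lt_trans x0 xz).
  exact: is_deriveN.
- by rewrite oppr_ge0 df_le0 // (lt_trans x0).
- have ? := f_df _ (lt_le_trans x0 xz).
  by apply: is_derive_continuous; exact: is_deriveN.
Qed.

Definition sinh {R : realType} (t : R) : R := (expR t - expR (- t)) / 2.
Definition cosh {R : realType} (t : R) : R := (expR t + expR (- t)) / 2.

#[local] Instance is_derive_sinh {R : realType} (x : R) :
  is_derive x 1 sinh (cosh x).
Proof.
rewrite /sinh /cosh; apply: is_derive_eq.
by rewrite /GRing.scale/=; ring.
Qed.

#[local] Instance is_derive_cosh {R : realType} (x : R) :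
  is_derive x 1 cosh (sinh x).
Proof.
rewrite /sinh /cosh; apply: is_derive_eq.
by rewrite /GRing.scale/=; ring.
Qed.

Lemma sinh0 {R : realType} : sinh 0 = 0 :> R.
Proof. by rewrite /sinh oppr0 subrr mul0r. Qed.

Lemma cosh0 {R : realType} : cosh 0 = 1 :> R.
Proof. by rewrite /cosh oppr0 expR0; field. Qed.

Lemma cosh_gt0 {R : realType} (x : R) : 0 < cosh x.
Proof. by rewrite /cosh divr_gt0// addr_gt0// expR_gt0. Qed.

Lemma cosh2_sinh2 {R : realType} (x : R) : cosh x ^+ 2 - sinh x ^+ 2 = 1.
Proof.
have /= : expR x * expR (- x) = 1 by rewrite -expRD subrr expR0.
by rewrite /cosh /sinh => h; nra.
Qed.

Lemma sinh2x {R : realType} (x : R) : sinh (2 * x) = 2 * sinh x * cosh x.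
Proof.
by rewrite /sinh /cosh -mulrN !expRM_natl; field.
Qed.

Lemma cosh_ge1 {R : realType} (x : R) : 1 <= cosh x.
Proof. by have := cosh2_sinh2 x; have := cosh_gt0 x; nra. Qed.

Lemma sinh_ge {R : realType} (x : R) : 0 <= x -> x <= sinh x.
Proof.
move=> x0; rewrite -subr_ge0.
apply: (@ge0_of_derive _ (fun y => sinh y - y) (fun y => cosh y - 1)) => //.
- by rewrite sinh0 subr0.
- by move=> z _; rewrite subr_ge0 cosh_ge1.
Qed.

Lemma sinh_gt0 {R : realType} (x : R) : 0 < x -> 0 < sinh x.
Proof. by move=> x0; rewrite (lt_le_trans x0)// sinh_ge// ltW. Qed.

Lemma cosh_ge {R : realType} (x : R) : 0 <= x -> 1 + x ^+ 2 / 2 <= cosh x.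
Proof.
move=> x0; rewrite -subr_ge0.
apply: (@ge0_of_derive _ (fun y => cosh y - (1 + y ^+ 2 / 2))
          (fun y => sinh y - y)) => //.
- move=> z; apply: is_derive_eq.
  by rewrite /GRing.scale/=; field.
- by rewrite cosh0; ring.
- by move=> z z0; rewrite subr_ge0 sinh_ge.
Qed.

Lemma sinh_lt_mul_cosh {R : realType} (x : R) : 0 < x -> sinh x < x * cosh x.
Proof.
(* Removing [x ^+ 3 / 3], the leading term of the difference, leaves a weak inequality that still
   yields the strict one. *)
move=> x0; suff : 0 <= x * cosh x - sinh x - x ^+ 3 / 3.
  have : 0 < x ^+ 3 by rewrite exprn_gt0.
  lra.
apply: (@ge0_of_derive _ (fun y => y * cosh y - sinh y - y ^+ 3 / 3)
          (fun y => y * (sinh y - y))) (ltW x0) => //.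
- move=> z; apply: is_derive_eq.
  by rewrite /GRing.scale/=; field.
- by rewrite sinh0; ring.
- by move=> z z0; rewrite mulr_ge0// subr_ge0 sinh_ge.
Qed.

(* The coefficient of [x ^ (2 n)] in the difference is
   [(4 ^ n - 4 n ^ 2) / (2 n)`!]; it vanishes for [n = 1] and [n = 2], so the
   sign only shows on the fifth derivative. *)
Lemma cosh2x_ge {R : realType} (x : R) : 0 <= x ->
  x * sinh x + x ^+ 2 * cosh x <= cosh (2 * x) - 1.
Proof.
move=> x0; rewrite -subr_ge0.
have der5 z : 0 <= z -> 0 <= 32 * sinh (2 * z) - 25 * sinh z
    - 11 * z * cosh z - z ^+ 2 * sinh z :> R.
  move=> z0; rewrite sinh2x.
  have := cosh_ge _ z0; have := sinh_ge _ z0 => zs zc.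
  (* Splitting [sinh z] as [(sinh z - z) + z] gives two products whose second factors are
     nonnegative because [1 + z ^+ 2 / 2 <= cosh z]. *)
  have -> : 32 * (2 * sinh z * cosh z) - 25 * sinh z - 11 * z * cosh z -
    z ^+ 2 * sinh z = (sinh z - z) * (64 * cosh z - 25 - z ^+ 2) +
      z * (53 * cosh z - 25 - z ^+ 2) by ring.
  by rewrite addr_ge0// mulr_ge0// ?subr_ge0//; nra.
pose f4 (z : R) := 16 * cosh (2 * z) - 16 * cosh z - 9 * z * sinh z
    - z ^+ 2 * cosh z.
pose f3 (z : R) := 8 * sinh (2 * z) - 9 * sinh z - 7 * z * cosh z
    - z ^+ 2 * sinh z.
pose f2 (z : R) := 4 * cosh (2 * z) - 4 * cosh z - 5 * z * sinh z
    - z ^+ 2 * cosh z.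
pose f1 (z : R) := 2 * sinh (2 * z) - sinh z - 3 * z * cosh z
    - z ^+ 2 * sinh z.
pose f0 (z : R) := cosh (2 * z) - 1 - (z * sinh z + z ^+ 2 * cosh z).
rewrite -[leRHS]/(f0 x).
have der4 z : 0 <= z -> 0 <= f4 z.
  apply: (ge0_of_derive _ _ _ _ _ der5) => [{}z|].
    by apply: is_derive_eq; rewrite /GRing.scale/=; ring.
  by rewrite /f4 !(mulr0, sinh0, cosh0); ring.
have der3 z : 0 <= z -> 0 <= f3 z.
  apply: (ge0_of_derive _ _ _ _ _ der4) => [{}z|].
    by apply: is_derive_eq; rewrite /f4/GRing.scale/=; ring.
  by rewrite /f3 !(mulr0, sinh0, cosh0); ring.
have der2 z : 0 <= z -> 0 <= f2 z.
  apply: (ge0_of_derive _ _ _ _ _ der3) => [{}z|].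
    by apply: is_derive_eq; rewrite /f3/GRing.scale/=; ring.
  by rewrite /f2 !(mulr0, sinh0, cosh0); ring.
have der1 z : 0 <= z -> 0 <= f1 z.
  apply: (ge0_of_derive _ _ _ _ _ der2) => [{}z|].
    by apply: is_derive_eq; rewrite /f2/GRing.scale/=; ring.
  by rewrite /f1 !(mulr0, sinh0, cosh0); ring.
apply: (ge0_of_derive _ _ _ _ _ der1) => // [z|].
  by apply: is_derive_eq; rewrite /f1/GRing.scale/=; ring.
by rewrite /f0 !(mulr0, sinh0, cosh0); ring.
Qed.

Lemma cosh2x {R : realType} (x : R) : cosh (2 * x) = 1 + 2 * sinh x ^+ 2.
Proof.
have /= : expR x * expR (- x) = 1 by rewrite -expRD subrr expR0.
by rewrite /sinh /cosh -mulrN !expRM_natl => h; nra.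
Qed.

Lemma div_sinh_antitone {R : realType} (x y : R) : 0 < x -> x <= y ->
  y / sinh y <= x / sinh x.
Proof.
apply: (@ge_le0_derive _ (fun z => z / sinh z)
  (fun z => (sinh z - z * cosh z) / sinh z ^+ 2)) => z z0.
  have s0 : sinh z != 0 by rewrite gt_eqF// sinh_gt0.
  have ? := is_deriveV s0 (is_derive_sinh z).
  by apply: is_derive_eq; rewrite /GRing.scale/=; field.
by rewrite pmulr_lle0 ?invr_gt0 ?exprn_gt0 ?sinh_gt0// subr_le0 ltW//
  sinh_lt_mul_cosh.
Qed.

(** As [2 * sinh z ^+ 2 = cosh (2 * z) - 1], the sign of the derivative is exactly [cosh2x_ge]. *)
Lemma one_sub_div_sinh_antitone {R : realType} (x y : R) : 0 < x -> x <= y ->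
  (1 - y / sinh y) / y ^+ 2 <= (1 - x / sinh x) / x ^+ 2.
Proof.
apply: (@ge_le0_derive _ (fun z => (1 - z / sinh z) / z ^+ 2)
  (fun z => (z * sinh z + z ^+ 2 * cosh z - 2 * sinh z ^+ 2) /
     (z ^+ 3 * sinh z ^+ 2))) => z z0.
  have s0 : sinh z != 0 by rewrite gt_eqF// sinh_gt0.
  have z20 : z ^+ 2 != 0 by rewrite gt_eqF// exprn_gt0.
  have ? := is_deriveV s0 (is_derive_sinh z).
  have ? : is_derive z 1 (fun y => (y ^+ 2)^-1) (- (z ^+ 2) ^- 2 *: (2 * z)).
    apply: (@is_deriveV _ (fun y => y ^+ 2)) => //.
    by apply: is_derive_eq; rewrite /GRing.scale/=; ring.
  apply: is_derive_eq; rewrite /GRing.scale/=; field.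
  by rewrite s0 gt_eqF.
rewrite pmulr_lle0; last by rewrite invr_gt0 mulr_gt0// exprn_gt0// sinh_gt0.
have := cosh2x_ge _ (ltW z0); rewrite cosh2x; lra.
Qed.

(** * The function [fbeta] *)

Lemma tanhE {R : realType} (t : R) : tanh t = sinh t / cosh t.
Proof.
rewrite /tanh /sinh /cosh; field.
by rewrite gt_eqF// addr_gt0// expR_gt0.
Qed.

Lemma is_derive_tanh {R : realType} (t : R) :
  is_derive t 1 (@tanh R) (1 / cosh t ^+ 2).
Proof.
have c0 : cosh t != 0 by rewrite gt_eqF// cosh_gt0.
rewrite (_ : @tanh R = fun y => sinh y / cosh y); last first.
  by apply/funext => y; exact: tanhE.
have ? := is_deriveV c0 (is_derive_cosh t).
apply: is_derive_eq; rewrite /GRing.scale/=.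
have -> : 1 / cosh t ^+ 2 = (cosh t ^+ 2 - sinh t ^+ 2) / cosh t ^+ 2.
  by rewrite cosh2_sinh2.
by field.
Qed.

Lemma tanh_le {R : realType} (x y : R) : 0 <= x -> x <= y -> tanh x <= tanh y.
Proof.
apply: (@le_ge0_derive _ _ (fun t => 1 / cosh t ^+ 2)) => z _.
- exact: is_derive_tanh.
- by rewrite divr_ge0// sqr_ge0.
- exact: is_derive_continuous (is_derive_tanh z).
Qed.

Lemma tanh_le1 {R : realType} (t : R) : tanh t <= 1.
Proof.
rewrite /tanh ler_pdivrMr ?mul1r; last by rewrite addr_gt0// expR_gt0.
have := expR_gt0 (- t); lra.
Qed.

(** One profile for every finite [beta]: up to the scaling [b / 2] of argument and value,
    [fbeta b%:E] is [tanhc]. *)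
Definition tanhc {R : realType} (t : R) : R := if t == 0 then 1 else tanh t / t.

Lemma tanhcE {R : realType} (t : R) : 0 < t ->
  tanhc t = sinh t / (t * cosh t).
Proof.
move=> t0; rewrite /tanhc gt_eqF// tanhE.
by field; rewrite !gt_eqF// cosh_gt0.
Qed.

Lemma tanhc0 {R : realType} : tanhc 0 = 1 :> R.
Proof. by rewrite /tanhc eqxx. Qed.

Lemma tanhc_gt0 {R : realType} (t : R) : 0 <= t -> 0 < tanhc t.
Proof.
rewrite le_eqVlt => /predU1P[<-|t0]; first by rewrite tanhc0.
by rewrite tanhcE// divr_gt0 ?sinh_gt0// mulr_gt0// cosh_gt0.
Qed.

Lemma tanhc_lt1 {R : realType} (t : R) : 0 < t -> tanhc t < 1.
Proof.
move=> t0; rewrite tanhcE// ltr_pdivrMr ?mul1r ?sinh_lt_mul_cosh//.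
by rewrite mulr_gt0// cosh_gt0.
Qed.

(** The double argument comes from [cosh t / sinh t - sinh t / cosh t = 2 / sinh (2 * t)]. *)
Lemma is_derive_ln_tanhc {R : realType} (t : R) : 0 < t ->
  is_derive t 1 (fun y => ln (tanhc y)) ((2 * t / sinh (2 * t) - 1) / t).
Proof.
move=> t0; have s0 := sinh_gt0 _ t0; have c0 := cosh_gt0 t.
apply: (@near_eq_is_derive _ _ _
  (fun y => ln (sinh y) - ln y - ln (cosh y))).
  near=> y; have y0 : 0 < y by near: y; exact: lt_nbhsr.
  rewrite tanhcE// ln_div ?posrE ?sinh_gt0//; last first.
    by rewrite mulr_gt0// cosh_gt0.
  by rewrite lnM ?posrE ?cosh_gt0// opprD addrA.
have ? := is_derive1_comp (is_derive1_ln s0) (is_derive_sinh t).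
have ? := is_derive1_comp (is_derive1_ln c0) (is_derive_cosh t).
have ? := is_derive1_ln t0.
apply: is_derive_eq; rewrite sinh2x.
have -> : (cosh t)^-1 * sinh t =
    cosh t / sinh t - (cosh t ^+ 2 - sinh t ^+ 2) / (sinh t * cosh t).
  by field; rewrite !gt_eqF.
by rewrite cosh2_sinh2; field; rewrite !gt_eqF.
Unshelve. all: by end_near. Qed.

Lemma continuous_tanhc {R : realType} (t : R) : 0 <= t ->
  {for t, continuous tanhc}.
Proof.
rewrite le_eqVlt => /predU1P[<-|t0].
  (* At [0], [tanh h / h] is the difference quotient of [tanh], so its limit is the derivative
     there. *)
  apply/continuous_withinNx; rewrite tanhc0.
  have [+ +] := is_derive_tanh (0 : R).
  rewrite cosh0 expr1n divr1 /derivable /derive => dtanh dE.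
  rewrite -[X in _ --> X]dE; apply: cvg_trans dtanh; apply: near_eq_cvg.
  near=> h; have h0 : h != 0 by near: h; exact: nbhs_dnbhs_neq.
  rewrite /tanhc (negbTE h0) [tanh 0]/tanh oppr0 subrr mul0r subr0.
  by rewrite /GRing.scale/= mulr1 addr0 mulrC.
have dtanh := is_derive_tanh t.
have dinv := is_deriveV (lt0r_neq0 t0) (is_derive_id t 1).
apply: (@is_derive_continuous _ tanhc t).
apply: (near_eq_is_derive _ (is_deriveM dtanh dinv)).
near=> y; have y0 : 0 < y by near: y; exact: lt_nbhsr.
by rewrite /tanhc gt_eqF.
Unshelve. all: by end_near. Qed.

Lemma continuous_ln_tanhc {R : realType} (t : R) : 0 <= t ->
  {for t, continuous (fun y => ln (tanhc y))}.
Proof.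
move=> t0; apply: continuous_comp; first exact: continuous_tanhc.
exact/continuous_ln/tanhc_gt0.
Qed.

Lemma tanhc_antitone {R : realType} (x y : R) : 0 <= x -> x <= y ->
  tanhc y <= tanhc x.
Proof.
move=> x0 xy; have y0 := le_trans x0 xy.
rewrite -ler_ln ?posrE ?tanhc_gt0// -lerN2.
apply: (@le_ge0_derive _ (fun t => - ln (tanhc t))
  (fun t => (1 - 2 * t / sinh (2 * t)) / t) 0) => // t t0.
- have ? := is_derive_ln_tanhc _ t0.
  by apply: is_derive_eq; rewrite -mulNr opprB.
- have t20 : 0 < 2 * t by rewrite mulr_gt0.
  rewrite divr_ge0 ?(ltW t0)// subr_ge0 ler_pdivrMr ?sinh_gt0// mul1r.
  by rewrite sinh_ge// ltW.
- exact: cvgN (continuous_ln_tanhc _ t0).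
Qed.

(** * Monotonicity, cross ratios and log-convexity of [fbeta] *)

Lemma fbeta_tanhc {R : realType} (b t : R) : b != 0 ->
  fbeta b%:E t = b / 2 * tanhc (b / 2 * t).
Proof.
move=> b0; rewrite /fbeta /tanhc mulf_eq0 mulf_eq0 invr_eq0 (negbTE b0).
rewrite pnatr_eq0/=; case: ifPn => t0; first by rewrite mulr1.
by rewrite (mulrAC b); field; rewrite b0 t0.
Qed.

Lemma fbeta_gt0 {R : realType} (b t : R) : 0 < b -> 0 <= t -> 0 < fbeta b%:E t.
Proof.
move=> b0 t0; rewrite fbeta_tanhc ?gt_eqF// mulr_gt0 ?divr_gt0//.
by rewrite tanhc_gt0// mulr_ge0// divr_ge0// ltW.
Qed.

Lemma fbeta0 {R : realType} (b : R) : fbeta b%:E 0 = b / 2.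
Proof. by rewrite /fbeta eqxx. Qed.

Lemma fbeta_lt {R : realType} (b t : R) : 0 < b -> 0 < t ->
  fbeta b%:E t < b / 2.
Proof.
move=> b0 t0; rewrite fbeta_tanhc ?gt_eqF// gtr_pMr ?divr_gt0//.
by rewrite tanhc_lt1// mulr_gt0// divr_gt0.
Qed.

Lemma fbeta_antitone {R : realType} (b x y : R) : 0 < b -> 0 <= x -> x <= y ->
  fbeta b%:E y <= fbeta b%:E x.
Proof.
move=> b0 x0 xy; have h0 : 0 <= b / 2 by rewrite divr_ge0// ltW.
rewrite !fbeta_tanhc ?gt_eqF// ler_wpM2l//.
by apply: tanhc_antitone; [exact: mulr_ge0|exact: ler_wpM2l].
Qed.

Lemma fbeta_le_inv {R : realType} (b t : R) : 0 < t -> fbeta b%:E t <= t^-1.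
Proof.
by move=> t0; rewrite /fbeta gt_eqF// ler_pdivrMr// mulVf ?gt_eqF// tanh_le1.
Qed.

Lemma fbeta_homo_beta {R : realType} (b c t : R) : 0 < b -> b <= c -> 0 <= t ->
  fbeta b%:E t <= fbeta c%:E t.
Proof.
move=> b0 bc; rewrite /fbeta le_eqVlt => /predU1P[<-|t0].
  by rewrite eqxx ler_wpM2r.
rewrite gt_eqF// ler_wpM2r ?invr_ge0 ?(ltW t0)//.
rewrite tanh_le ?ler_wpM2r ?(ltW t0)//.
by rewrite divr_ge0// mulr_ge0// ltW.
Qed.

(* The derivative of [ln (tanh (p t)) - ln (tanh (q t))] is
   [(P (2 p t) - P (2 q t)) / t] with [P y = y / sinh y] decreasing. *)
Lemma fbeta_cross {R : realType} (b c x y : R) : 0 < b -> b <= c ->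
  0 <= x -> x <= y ->
  fbeta b%:E x * fbeta c%:E y <= fbeta c%:E x * fbeta b%:E y.
Proof.
move=> b0 bc x0 xy; have c0 := lt_le_trans b0 bc.
have y0 := le_trans x0 xy.
rewrite !fbeta_tanhc ?gt_eqF//; set p := b / 2; set q := c / 2.
have p0 : 0 < p by rewrite divr_gt0.
have q0 : 0 < q by rewrite divr_gt0.
have pq : p <= q by rewrite ler_wpM2r.
have T0 (r t : R) : 0 < r -> 0 <= t -> 0 < tanhc (r * t).
  by move=> r0 t0; rewrite tanhc_gt0// mulr_ge0// ltW.
rewrite mulrACA [leRHS]mulrACA (mulrC q p) ler_pM2l ?mulr_gt0//.
rewrite [leRHS]mulrC -ler_ln ?posrE ?mulr_gt0 ?T0// !lnM ?posrE ?T0//.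
rewrite -lerBlDr addrAC -lerBrDr.
have dmul (r t : R) : is_derive t 1 (fun y => r * y) r.
  by apply: is_derive_eq; rewrite /GRing.scale/= mulr1.
have lnTc (r t : R) : 0 < r -> 0 < t -> is_derive t 1 (fun t => ln (tanhc (r * t)))
    ((2 * (r * t) / sinh (2 * (r * t)) - 1) / t).
  move=> r0 t0.
  have dln := is_derive_ln_tanhc _ (mulr_gt0 r0 t0).
  apply: (is_derive_eq (is_derive1_comp dln (dmul r t))); field.
  by rewrite !gt_eqF// sinh_gt0// !mulr_gt0.
have lnTcont (r t : R) : 0 < r -> 0 <= t ->
    {for t, continuous (fun t => ln (tanhc (r * t)))}.
  move=> r0 t0; have rt0 : 0 <= r * t by rewrite mulr_ge0// ltW.
  exact: (continuous_comp (is_derive_continuous _ _ _ (dmul r t))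
                          (continuous_ln_tanhc _ rt0)).
apply: (@le_ge0_derive _
  (fun t => ln (tanhc (p * t)) - ln (tanhc (q * t)))
  (fun t => (2 * (p * t) / sinh (2 * (p * t)) -
             2 * (q * t) / sinh (2 * (q * t))) / t) 0) => // t t0.
- have ? := lnTc _ _ p0 t0; have ? := lnTc _ _ q0 t0.
  by apply: is_derive_eq; ring.
- rewrite divr_ge0 ?(ltW t0)// subr_ge0 div_sinh_antitone ?mulr_gt0//.
  by rewrite ler_wpM2l// ler_wpM2r// ltW.
- exact: cvgB (lnTcont _ _ p0 t0) (lnTcont _ _ q0 t0).
Qed.

(* With [c = b / 2] and [y = 2 c (sqrt s)], the derivative of
   [ln (tanhc (c * sqrt s))] in [s] is [- 2 c ^ 2 (1 - y / sinh y) / y ^ 2],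
   so this is one_sub_div_sinh_antitone integrated. *)
Lemma fbeta_sqrt_log_convex {R : realType} (b s t d : R) : 0 < b ->
  0 <= s -> s <= t -> 0 <= d ->
  fbeta b%:E (Num.sqrt (s + d)) * fbeta b%:E (Num.sqrt t) <=
  fbeta b%:E (Num.sqrt s) * fbeta b%:E (Num.sqrt (t + d)).
Proof.
move=> b0 s0 st d0; set c := b / 2.
have c0 : 0 < c by rewrite divr_gt0.
have c2_0 : 0 < 2 * c by rewrite mulr_gt0.
have t0 := le_trans s0 st.
rewrite !fbeta_tanhc ?gt_eqF// -/c; clearbody c.
rewrite mulrACA [leRHS]mulrACA.
rewrite ler_pM2l ?mulr_gt0//.
have csqrt_ge0 r : 0 <= c * Num.sqrt r by rewrite mulr_ge0 ?sqrtr_ge0// ltW.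
rewrite -ler_ln ?posrE ?mulr_gt0 ?tanhc_gt0// !lnM ?posrE ?tanhc_gt0//.
suff : ln (tanhc (c * Num.sqrt (s + d))) - ln (tanhc (c * Num.sqrt s)) <=
    ln (tanhc (c * Num.sqrt (t + d))) - ln (tanhc (c * Num.sqrt t)) by lra.
pose q (r : R) := let y := 2 * c * Num.sqrt r in (1 - y / sinh y) / y ^+ 2.
have dsqrt (r : R) : 0 < r -> is_derive r 1 (fun r => c * Num.sqrt r)
    (c / (2 * Num.sqrt r)).
  move=> r0; have ? := is_derive1_sqrt r0.
  by apply: is_derive_eq.
have dln (r : R) : 0 < r -> is_derive r 1
    (fun r => ln (tanhc (c * Num.sqrt r))) (- (2 * c ^+ 2) * q r).
  move=> r0; have sqr0 : 0 < Num.sqrt r by rewrite sqrtr_gt0.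
  have dlnT := is_derive_ln_tanhc _ (mulr_gt0 c0 sqr0).
  apply: (is_derive_eq (is_derive1_comp (g := fun r => c * Num.sqrt r) dlnT
    (dsqrt _ r0))).
  rewrite /q/= -(mulrA 2 c); field.
  by rewrite !gt_eqF// sinh_gt0// !mulr_gt0.
have dshift (r : R) : is_derive r 1 (fun r => r + d) 1.
  by apply: is_derive_eq; rewrite addr0.
have lnTcont (r : R) : {for r, continuous (fun r => ln (tanhc (c * Num.sqrt r)))}.
  apply: (continuous_comp (f := fun r => c * Num.sqrt r)
    (g := fun y => ln (tanhc y))); last exact: continuous_ln_tanhc.
  by apply: continuousM; [exact: cst_continuous|exact: sqrt_continuous].
apply: (@le_ge0_derive _
  (fun r => ln (tanhc (c * Num.sqrt (r + d))) - ln (tanhc (c * Num.sqrt r)))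
  (fun r => 2 * c ^+ 2 * (q r - q (r + d))) 0) => // r r0.
- have rd0 : 0 < r + d by rewrite ltr_wpDr.
  have ? := is_derive1_comp (g := +%R^~ d) (dln _ rd0) (dshift r).
  have ? := dln _ r0.
  by apply: is_derive_eq; ring.
- rewrite pmulr_rge0; last by rewrite mulr_gt0// exprn_gt0.
  rewrite subr_ge0.
  apply: one_sub_div_sinh_antitone; first by rewrite mulr_gt0// sqrtr_gt0.
  by rewrite ler_wpM2l ?(ltW c2_0)// ler_wsqrtr// lerDl.
- apply: continuousB; last exact: lnTcont.
  exact: (continuous_comp (is_derive_continuous _ _ _ (dshift r))
                          (lnTcont (r + d))).
Qed.

Lemma continuous_sqrt_sqrD {R : realType} (s : R) :
  continuous (fun w : R => Num.sqrt (w ^+ 2 + s)).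
Proof.
move=> w; have sqrD : {for w, continuous (fun w : R => w ^+ 2 + s)}.
  apply: continuousD; first exact: exprn_continuous.
  exact: cst_continuous.
by have := continuous_comp sqrD (@sqrt_continuous R _); apply.
Qed.

Lemma continuous_fbeta_sqrt {R : realType} (b s : R) : 0 < b ->
  continuous (fun w : R => fbeta b%:E (Num.sqrt (w ^+ 2 + s))).
Proof.
move=> b0 w.
rewrite (_ : (fun w => _) =
  (fun w => b / 2 * tanhc (b / 2 * Num.sqrt (w ^+ 2 + s)))); last first.
  by apply/funext => r; rewrite fbeta_tanhc// gt_eqF.
have arg : {for w, continuous (fun w : R => b / 2 * Num.sqrt (w ^+ 2 + s))}.
  apply: continuousM; first exact: cst_continuous.
  exact: continuous_sqrt_sqrD.
have arg_ge0 : 0 <= b / 2 * Num.sqrt (w ^+ 2 + s).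
  by rewrite mulr_ge0 ?sqrtr_ge0// divr_ge0// ltW.
have cst2 : {for w, continuous (cst (b / 2) : R -> R)} by exact: cst_continuous.
by have := continuousM cst2 (continuous_comp arg (continuous_tanhc _ arg_ge0)); apply.
Qed.

(** * Maximum and minimum sums *)

Lemma setmax_eq {R : realType} (A : set R) (m : R) :
  A m -> ubound A m -> setmax A = m.
Proof.
move=> Am ubm; apply: xget_subset1 => // x y [Ax ubx] [Ay uby].
by apply/eqP; rewrite eq_le ubx// uby.
Qed.

Lemma setmin_eq {R : realType} (A : set R) (m : R) :
  A m -> lbound A m -> setmin A = m.
Proof.
move=> Am lbm; apply: xget_subset1 => // x y [Ax lbx] [Ay lby].
by apply/eqP; rewrite eq_le lbx// lby.
Qed.

(** * Endpoints of partition cells, and the sums evaluated there *)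

Lemma opitv_le {R : realType} (p : R * R) (a b : R) : p.1 < p.2 ->
  opitv p `<=` `[a, b] -> a <= p.1 /\ p.2 <= b.
Proof.
case: p => p1 p2 /= p12 sub; split; rewrite leNgt; apply/negP => lt.
  (* If [p1 < a], the midpoint of [p1] and [m] lies in the open interval but left of [a]. *)
  pose m := Num.min a p2; have p1m : p1 < m by rewrite lt_min lt p12.
  have mp2 : m <= p2 by rewrite ge_min lexx orbT.
  have ma : m <= a by rewrite ge_min lexx.
  have /sub : opitv (p1, p2) ((p1 + m) / 2).
    by rewrite /opitv/= in_itv/=; apply/andP; split; lra.
  by rewrite /= in_itv/= => /andP[? ?]; lra.
pose m := Num.max b p1; have mp2 : m < p2 by rewrite gt_max lt p12.
have p1m : p1 <= m by rewrite le_max lexx orbT.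
have bm : b <= m by rewrite le_max lexx.
have /sub : opitv (p1, p2) ((m + p2) / 2).
  by rewrite /opitv/= in_itv/=; apply/andP; split; lra.
by rewrite /= in_itv/= => /andP[? ?]; lra.
Qed.

Lemma is_partition_bounds {R : realType} N (I : 'I_N -> R * R) (a b : R) k :
  is_partition I `[a, b] -> [/\ a <= (I k).1, (I k).1 < (I k).2 & (I k).2 <= b].
Proof.
case=> lt sub _ _; have [? ?] := opitv_le _ _ _ (lt k) (sub k).
by split.
Qed.

(** The closure covering the point [a] cannot begin before it. For the partition of [[0, a]] this
    provides a cell with left endpoint [0], the source of strict inequalities and of lower bounds on
    the max-sum. *)
Lemma is_partition_left {R : realType} N (I : 'I_N -> R * R) (a b : R) :
  a <= b -> is_partition I `[a, b] -> exists k, (I k).1 = a.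
Proof.
move=> ab hI; case: (hI) => _ _ _ /(_ a) [|k].
  by rewrite /= in_itv/= lexx.
rewrite /clitv/= in_itv/= => /andP[la _]; exists k.
by have [al _ _] := is_partition_bounds _ _ _ _ k hI; apply/eqP; rewrite eq_le la.
Qed.

(** Common form of both sums: left endpoints as sample points [x] give the max-sum, right endpoints
    the min-sum. *)
Definition wsum {R : realType} {N} (beta : \bar R) (x l : 'I_N -> R) (w : R) : R :=
  \sum_(k < N) fbeta beta (Num.sqrt (w ^+ 2 + x k ^+ 2)) * l k.

Lemma sqrt_sqrD_homo {R : realType} (w x y : R) : 0 <= x -> x <= y ->
  Num.sqrt (w ^+ 2 + x ^+ 2) <= Num.sqrt (w ^+ 2 + y ^+ 2).
Proof.
by move=> x0 xy; rewrite ler_wsqrtr// lerD2l lerXn2r// nnegrE (le_trans x0).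
Qed.

(** At [beta = +oo] the default value [0] at [t = 0] would break monotonicity; [0 < w] keeps the
    argument positive. *)
Lemma fbeta_sqrt_antitone {R : realType} (beta : \bar R) (w x y : R) :
  (0 < beta)%E -> (beta = +oo%E -> 0 < w) -> 0 <= x -> x <= y ->
  fbeta beta (Num.sqrt (w ^+ 2 + y ^+ 2)) <=
  fbeta beta (Num.sqrt (w ^+ 2 + x ^+ 2)).
Proof.
case: beta => [b| |]//; rewrite ?lte_fin => b0 w0 x0 xy.
  by rewrite fbeta_antitone ?sqrtr_ge0// sqrt_sqrD_homo.
have pos z : 0 < Num.sqrt (w ^+ 2 + z ^+ 2).
  by rewrite sqrtr_gt0 ltr_pwDl ?sqr_ge0// exprn_gt0// w0.
by rewrite /fbeta lef_pV2 ?posrE ?pos// sqrt_sqrD_homo.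
Qed.

Lemma maxsumE {R : realType} N (I : 'I_N -> R * R) (beta : \bar R) (w : R) :
  (0 < beta)%E -> (beta = +oo%E -> 0 < w) ->
  (forall k, 0 <= (I k).1) -> (forall k, (I k).1 < (I k).2) ->
  maxsum I beta w = wsum beta (fun k => (I k).1) (fun k => len (I k)) w.
Proof.
move=> beta0 w0 I0 I12; apply: eq_bigr => k _; congr (_ * _).
apply: setmax_eq; first by exists (I k).1; rewrite // /clitv/= in_itv/= lexx ltW.
move=> _ [x + <-]; rewrite /clitv/= in_itv/= => /andP[? _].
exact: fbeta_sqrt_antitone.
Qed.

Lemma minsumE {R : realType} N (I : 'I_N -> R * R) (beta : \bar R) (w : R) :
  (0 < beta)%E -> (beta = +oo%E -> 0 < w) ->
  (forall k, 0 <= (I k).1) -> (forall k, (I k).1 < (I k).2) ->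
  minsum I beta w = wsum beta (fun k => (I k).2) (fun k => len (I k)) w.
Proof.
move=> beta0 w0 I0 I12; apply: eq_bigr => k _; congr (_ * _).
apply: setmin_eq; first by exists (I k).2; rewrite // /clitv/= in_itv/= lexx andbT ltW.
move=> _ [x + <-]; rewrite /clitv/= in_itv/= => /andP[? ?].
by apply: fbeta_sqrt_antitone; rewrite // (le_trans (I0 k)).
Qed.

Lemma fbeta_ge0 {R : realType} (beta : \bar R) (t : R) :
  (0 < beta)%E -> 0 <= t -> 0 <= fbeta beta t.
Proof.
case: beta => [b| |]//; last by rewrite /= invr_ge0.
by rewrite lte_fin => b0 t0; rewrite ltW// fbeta_gt0.
Qed.

Lemma fbeta_le_invr {R : realType} (beta : \bar R) (t : R) :
  (0 < beta)%E -> 0 < t -> fbeta beta t <= t^-1.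
Proof. by case: beta => [b| |]// _ t0; exact: fbeta_le_inv. Qed.

Lemma wsum_ge0 {R : realType} N (beta : \bar R) (x l : 'I_N -> R) (w : R) :
  (0 < beta)%E -> (forall k, 0 <= l k) -> 0 <= wsum beta x l w.
Proof.
by move=> b0 l0; rewrite sumr_ge0// => k _; rewrite mulr_ge0// fbeta_ge0// sqrtr_ge0.
Qed.

(** Termwise, [fbeta beta t <= t^-1] with [w <= t]. The bound does not depend on [w], which forces
    the sign change at large arguments in the intermediate value argument. *)
Lemma mul_wsum_le {R : realType} N (beta : \bar R) (x l : 'I_N -> R) (w : R) :
  (0 < beta)%E -> (forall k, 0 <= l k) -> 0 < w ->
  w * wsum beta x l w <= \sum_k l k.
Proof.
move=> b0 l0 w0; rewrite /wsum mulr_sumr ler_sum// => k _.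
rewrite mulrA ler_piMl//.
have ww : w <= Num.sqrt (w ^+ 2 + x k ^+ 2).
  rewrite -[leLHS]gtr0_norm// -sqrtr_sqr ler_wsqrtr// lerDl sqr_ge0//.
have s0 := lt_le_trans w0 ww.
rewrite -ler_pdivlMl// mulr1 (le_trans (fbeta_le_invr _ _ b0 s0))//.
by rewrite lef_pV2.
Qed.

Lemma continuous_wsum {R : realType} N (beta : \bar R) (x l : 'I_N -> R) (w : R) :
  (0 < beta)%E -> (beta = +oo%E -> 0 < w) ->
  {for w, continuous (wsum beta x l)}.
Proof.
move=> b0 w0; rewrite /wsum.
apply: cvg_big => [|k _]; first exact: add_continuous.
apply: cvgMr_tmp.
case: beta b0 w0 => [b| |]// b0 w0; first exact: continuous_fbeta_sqrt.
apply: cvgV; last exact: continuous_sqrt_sqrD.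
by rewrite gt_eqF// sqrtr_gt0 ltr_pwDl ?sqr_ge0// exprn_gt0// w0.
Qed.

(** Expanding into double sums reduces a cross inequality between sums to one for each pair of
    terms. *)
Lemma ler_mul_sum {R : realType} N M (f f' l : 'I_N -> R) (g g' m : 'I_M -> R) :
  (forall j, 0 <= l j) -> (forall k, 0 <= m k) ->
  (forall j k, f j * g' k <= f' j * g k) ->
  (\sum_j f j * l j) * (\sum_k g' k * m k) <=
  (\sum_j f' j * l j) * (\sum_k g k * m k).
Proof.
move=> l0 m0 le; rewrite !big_distrlr/= ler_sum// => j _; rewrite ler_sum// => k _.
by rewrite mulrACA [leRHS]mulrACA ler_wpM2r// mulr_ge0.
Qed.

(** * Comparison of the sums with their values at [0] and at other [beta] *)

Lemma sqrt_sqr0D {R : realType} (x : R) : 0 <= x -> Num.sqrt (0 ^+ 2 + x ^+ 2) = x.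
Proof. by move=> x0; rewrite expr0n add0r sqrtr_sqr ger0_norm. Qed.

Lemma fbeta_sqrt_sqr_le {R : realType} (b v w x : R) : 0 < b -> v ^+ 2 <= w ^+ 2 ->
  fbeta b%:E (Num.sqrt (w ^+ 2 + x ^+ 2)) <=
  fbeta b%:E (Num.sqrt (v ^+ 2 + x ^+ 2)).
Proof.
by move=> b0 vw; rewrite fbeta_antitone ?sqrtr_ge0// ler_wsqrtr// lerD2r.
Qed.

Lemma wsum_le_at0 {R : realType} N (b : R) (x l : 'I_N -> R) (w : R) :
  0 < b -> (forall k, 0 <= l k) -> wsum b%:E x l w <= wsum b%:E x l 0.
Proof.
move=> b0 l0; apply: ler_sum => k _; rewrite ler_wpM2r// fbeta_sqrt_sqr_le//.
by rewrite expr0n sqr_ge0.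
Qed.

Lemma wsum_lt_at0 {R : realType} N (b : R) (x l : 'I_N -> R) (w : R) (k0 : 'I_N) :
  0 < b -> (forall k, 0 < l k) -> x k0 = 0 -> w != 0 ->
  wsum b%:E x l w < wsum b%:E x l 0.
Proof.
move=> b0 l0 xk0 w0; rewrite /wsum (bigD1 k0)// [ltRHS](bigD1 k0)//.
apply: ltr_leD; last first.
  apply: ler_sum => k _; rewrite ler_wpM2r ?(ltW (l0 k))//.
  by rewrite fbeta_sqrt_sqr_le// expr0n sqr_ge0.
rewrite ltr_pM2r// xk0 sqrt_sqr0D// fbeta0 fbeta_lt// expr0n addr0.
by rewrite sqrtr_gt0 exprn_even_gt0.
Qed.

Lemma wsum_homo_beta {R : realType} N (b c : R) (x l : 'I_N -> R) (w : R) :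
  0 < b -> b <= c -> (forall k, 0 <= l k) -> wsum b%:E x l w <= wsum c%:E x l w.
Proof.
move=> b0 bc l0; apply: ler_sum => k _.
by rewrite ler_wpM2r// fbeta_homo_beta// sqrtr_ge0.
Qed.

Lemma wsum_cross_beta {R : realType} N M (b c : R)
    (x l : 'I_N -> R) (y m : 'I_M -> R) :
  0 < b -> b <= c -> (forall j, 0 <= l j) -> (forall k, 0 <= m k) ->
  (forall j, 0 <= x j) -> (forall j k, x j <= y k) ->
  wsum b%:E x l 0 * wsum c%:E y m 0 <= wsum c%:E x l 0 * wsum b%:E y m 0.
Proof.
move=> b0 bc l0 m0 x0 xy; apply: ler_mul_sum => // j k.
by rewrite !sqrt_sqr0D// ?(le_trans (x0 j))// fbeta_cross.
Qed.

Lemma wsum_cross {R : realType} N M (b : R) (x l : 'I_N -> R) (y m : 'I_M -> R)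
    (u v : R) :
  0 < b -> (forall j, 0 <= l j) -> (forall k, 0 <= m k) ->
  (forall j, 0 <= x j) -> (forall j k, x j <= y k) -> v ^+ 2 <= u ^+ 2 ->
  wsum b%:E x l u * wsum b%:E y m 0 <= wsum b%:E x l 0 * wsum b%:E y m v.
Proof.
move=> b0 l0 m0 x0 xy vu; apply: ler_mul_sum => // j k.
(* Replacing [u] by [v] only raises the first factor; log-convexity then moves the shift [v ^+ 2]
   from [x j ^+ 2] to [y k ^+ 2]. *)
apply: (@le_trans _ _ (fbeta b%:E (Num.sqrt (v ^+ 2 + x j ^+ 2)) *
                       fbeta b%:E (Num.sqrt (0 ^+ 2 + y k ^+ 2)))).
  by rewrite ler_wpM2r ?fbeta_ge0 ?sqrtr_ge0// fbeta_sqrt_sqr_le.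
rewrite [0 ^+ 2]expr0n !add0r ![v ^+ 2 + _]addrC.
rewrite fbeta_sqrt_log_convex ?sqr_ge0//.
by rewrite lerXn2r ?nnegrE// (le_trans (x0 j)).
Qed.

(** By log-convexity the relative drop of each term is smaller at [y k] than at [x k]; the value at
    [y k] is smaller too, hence so is the absolute drop. *)
Lemma wsum_drop_le {R : realType} N (b : R) (x y l : 'I_N -> R) (v : R) :
  0 < b -> (forall k, 0 <= l k) -> (forall k, 0 <= x k) ->
  (forall k, x k <= y k) ->
  wsum b%:E y l 0 - wsum b%:E y l v <= wsum b%:E x l 0 - wsum b%:E x l v.
Proof.
move=> b0 l0 x0 xy; rewrite -!sumrB; apply: ler_sum => k _.
rewrite -!mulrBl ler_wpM2r// [0 ^+ 2]expr0n !add0r ![v ^+ 2 + _]addrC.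
have xy2 : x k ^+ 2 <= y k ^+ 2 by rewrite lerXn2r ?nnegrE// (le_trans (x0 k)).
have v2 := sqr_ge0 v.
have := fbeta_sqrt_log_convex _ _ _ _ b0 (sqr_ge0 (x k)) xy2 v2.
have : fbeta b%:E (Num.sqrt (y k ^+ 2)) <= fbeta b%:E (Num.sqrt (x k ^+ 2)).
  by rewrite fbeta_antitone ?sqrtr_ge0// ler_wsqrtr.
have : fbeta b%:E (Num.sqrt (y k ^+ 2 + v ^+ 2)) <= fbeta b%:E (Num.sqrt (y k ^+ 2)).
  by rewrite fbeta_antitone ?sqrtr_ge0// ler_wsqrtr// lerDl.
have : 0 < fbeta b%:E (Num.sqrt (y k ^+ 2)) by rewrite fbeta_gt0 ?sqrtr_ge0.
(* [p] and [q] are the values at [x k] and [y k]; primes mark the values after the shift by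
   [v ^+ 2]. *)
move: (fbeta _ _) (fbeta _ _) (fbeta _ _) (fbeta _ _) => p' p q' q.
move=> q0 q'q qp lc; rewrite -(ler_pM2r q0).
have : q * (q - q') <= p * (q - q') by rewrite ler_wpM2r// subr_ge0.
by rewrite !mulrBl !mulrBr; lra.
Qed.

(** * The system *)

(* The bifurcation criterion [1 < A ((K1 - K2) + K2 ^ 2 B / (1 + K2 C))] at
   [u = v = 0], cleared of its denominator. *)
Definition supercritical {R : realType} (K1 K2 A B C : R) :=
  1 + K2 * C < A * ((K1 - K2) * (1 + K2 * C) + K2 ^+ 2 * B).

(** Divided by [D = 1 + K2 * C], the criterion is [1 < (K1 - K2) * A + K2 ^+ 2 * B * (A / D)], and
    the hypotheses make [A], [B] and [A / D] all grow. *)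
Lemma supercritical_homo {R : realType} (K1 K2 A B C A' B' C' : R) :
  0 < K2 -> K2 < K1 -> 0 <= B -> 0 <= C -> 0 <= A -> 0 <= C' -> A <= A' ->
  B <= B' -> A * C' <= A' * C ->
  supercritical K1 K2 A B C -> supercritical K1 K2 A' B' C'.
Proof.
rewrite /supercritical => K20 K21 B0 C0 A0 C'0 AA' BB' ACA'C sup.
have K120 : 0 < K1 - K2 by rewrite subr_gt0.
have D0 : 0 < 1 + K2 * C by rewrite ltr_pwDl// mulr_ge0// ltW.
have D'0 : 0 < 1 + K2 * C' by rewrite ltr_pwDl// mulr_ge0// ltW.
have ADA'D : A * (1 + K2 * C') <= A' * (1 + K2 * C).
  by have := ler_wpM2l (ltW K20) ACA'C; lra.
set D := 1 + K2 * C in sup D0 ADA'D *.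
set D' := 1 + K2 * C' in D'0 ADA'D *.
rewrite -(ltr_pM2r D0); apply: (@lt_le_trans _ _
  (A * ((K1 - K2) * D + K2 ^+ 2 * B) * D')); first by rewrite mulrC ltr_pM2r.
have -> : A * ((K1 - K2) * D + K2 ^+ 2 * B) * D' =
  A * ((K1 - K2) * D * D') + (A * D') * (K2 ^+ 2 * B) by ring.
have -> : A' * ((K1 - K2) * D' + K2 ^+ 2 * B') * D =
  A' * ((K1 - K2) * D * D') + (A' * D) * (K2 ^+ 2 * B') by ring.
apply: lerD; first by rewrite ler_wpM2r// !mulr_ge0// ltW.
apply: ler_pM => //; first by rewrite mulr_ge0// ltW.
  by rewrite mulr_ge0// sqr_ge0.
by rewrite ler_wpM2l ?sqr_ge0.
Qed.

(** [A], [B], [C] stand for the sums at a solution and [A0], [B0], [C0] for those at [0]. A solution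
    with [u != 0] would make the criterion hold at [0]; strictness comes from [A < A0] in the
    [K1 - K2] term. *)
Lemma trivial_of_not_supercritical {R : realType}
    (K1 K2 A B C A0 B0 C0 u v : R) :
  0 < K2 -> K2 < K1 -> 0 <= A -> 0 <= B -> 0 <= C -> 0 <= C0 ->
  (u != 0 -> A < A0) -> B <= B0 -> C <= C0 -> C0 - C <= B0 - B ->
  (v ^+ 2 <= u ^+ 2 -> A * C0 <= A0 * C) ->
  ~ supercritical K1 K2 A0 B0 C0 ->
  u = (K1 - K2) * u * A + K2 * v * B -> v + K2 * v * C = K2 * u * A ->
  u = 0 /\ v = 0.
Proof.
move=> K20 K21 A_ge0 B_ge0 C_ge0 C0_ge0 AA0 BB0 CC0 dropCB cross nsup equ eqv.
have K120 : 0 < K1 - K2 by rewrite subr_gt0.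
have D_gt0 : 0 < 1 + K2 * C by rewrite ltr_pwDl// mulr_ge0// ltW.
have D0_gt0 : 0 < 1 + K2 * C0 by rewrite ltr_pwDl// mulr_ge0// ltW.
have eqvD : v * (1 + K2 * C) = K2 * u * A by rewrite -eqv; ring.
have [u0|u0] := eqVneq u 0.
  split=> //; move: eqvD; rewrite u0 mulr0 mul0r => /eqP.
  by rewrite mulf_eq0 (gt_eqF D_gt0) orbF => /eqP.
exfalso; apply: nsup; rewrite /supercritical.
have {}AA0 := AA0 u0.
have eqG : 1 + K2 * C = A * ((K1 - K2) * (1 + K2 * C) + K2 ^+ 2 * B).
  apply: (mulfI u0).
  have : u * (1 + K2 * C) = (K1 - K2) * u * A * (1 + K2 * C)
      + K2 * B * (v * (1 + K2 * C)) by rewrite {1}equ; ring.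
  by rewrite eqvD => ->; ring.
set D := 1 + K2 * C in D_gt0 eqvD eqG *; set D0 := 1 + K2 * C0 in D0_gt0 *.
rewrite -(ltr_pM2r D_gt0).
have key : D * D0 < A0 * (K1 - K2) * (D * D0) + K2 ^+ 2 * (A0 * B0 * D).
  rewrite [ltLHS](_ : _ = A * (K1 - K2) * (D * D0) + K2 ^+ 2 * (A * B * D0));
    last by rewrite [in LHS]eqG; ring.
  apply: ltr_leD; first by rewrite !ltr_pM2r ?mulr_gt0.
  rewrite ler_wpM2l ?sqr_ge0//.
  have [qD|Dq] := leP (K2 * B) D.
    (* [B0 * D - B * D0 = (B0 - B) * D - K2 * B * (C0 - C)], which is at least
       [(C0 - C) * (D - K2 * B)]. *)
    have BD : B * D0 <= B0 * D.
      have : 0 <= (C0 - C) * (D - K2 * B) by rewrite mulr_ge0// subr_ge0.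
      have : 0 <= (B0 - B - (C0 - C)) * D by rewrite mulr_ge0 ?subr_ge0// ltW.
      by rewrite /D /D0; lra.
    rewrite -!mulrA; apply: ler_pM => //; last exact: ltW.
    by rewrite mulr_ge0// ltW.
  have AD : A * D0 <= A0 * D.
    (* Here [v = u * (K2 * A / D)]. From [D < K2 * B] and [eqG],
       [K2 * A * D <= A * (K2 ^+ 2 * B) <= D], so [K2 * A <= 1 <= D]. *)
    suff /cross : v ^+ 2 <= u ^+ 2.
      by have := ltW AA0; rewrite /D /D0 => ? /(ler_wpM2l (ltW K20)); lra.
    have vu : v = u * (K2 * A / D).
      by rewrite !mulrA (mulrC u) -eqvD mulfK// gt_eqF.
    rewrite vu exprMn ler_piMr ?sqr_ge0// -[leRHS](expr1n _ 2) lerXn2r ?nnegrE//.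
      by rewrite divr_ge0 ?mulr_ge0// ltW.
    rewrite ler_pdivrMr// mul1r.
    have D1 : 1 <= D by rewrite lerDl mulr_ge0// ltW.
    apply: le_trans D1; rewrite -(ler_pM2r D_gt0) mul1r {2}eqG [leRHS]mulrDr.
    apply: (@le_trans _ _ (K2 * A * (K2 * B))).
      by rewrite ler_wpM2l ?(ltW Dq)// mulr_ge0// ltW.
    rewrite (_ : K2 * A * (K2 * B) = A * (K2 ^+ 2 * B)); last by ring.
    by rewrite lerDr !mulr_ge0// ltW.
  rewrite mulrAC [leRHS]mulrAC; apply: ler_pM => //.
  by rewrite mulr_ge0// ltW.
by rewrite mulrC; lra.
Qed.

(* On [v > 0] the second equation gives [K2 u A(u) = v (1 + K2 C(v))]; put into
   the first one, it makes [u = v r(v)] explicit, and a single scalar equation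
   in [v] remains. *)
Lemma exists_positive_solution {R : realType} (K1 K2 W v0 : R) (A B C : R -> R) :
  let r v := (K1 - K2) / K2 * (1 + K2 * C v) + K2 * B v in
  0 < K2 -> K2 < K1 -> 0 <= W -> 0 <= v0 ->
  (forall v, v0 <= v -> 0 <= B v) -> (forall v, v0 <= v -> 0 <= C v) ->
  (forall u, 0 < u -> u * A u <= W) ->
  (forall v, v0 <= v -> {for v, continuous B}) ->
  (forall v, v0 <= v -> {for v, continuous C}) ->
  (forall v, v0 <= v -> {for v * r v, continuous A}) ->
  1 + K2 * C v0 < K2 * r v0 * A (v0 * r v0) ->
  exists u v : R, [/\ 0 < u, 0 < v,
    u = (K1 - K2) * u * A u + K2 * v * B v &
    v + K2 * v * C v = K2 * u * A u].
Proof.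
move=> r K20 K21 W0 v0_ge0 B0 C0 AW cB cC cA gap.
have K120 : 0 < K1 - K2 by rewrite subr_gt0.
have D_ge1 v : v0 <= v -> 1 <= 1 + K2 * C v.
  by move=> v0v; rewrite lerDl mulr_ge0 ?C0// ltW.
have r_gt0 v : v0 <= v -> 0 < r v.
  move=> v0v; rewrite ltr_wpDr ?mulr_ge0 ?B0 ?(ltW K20)//.
  by rewrite mulr_gt0 ?divr_gt0// (lt_le_trans ltr01)// D_ge1.
pose Psi v := K2 * r v * A (v * r v) - (1 + K2 * C v).
(* Since [v * r v * A (v * r v) <= W], one has [v1 * Psi v1 <= K2 * W - v1 <= 0]. *)
pose v1 := v0 + K2 * W + 1.
have KW0 : 0 <= K2 * W by rewrite mulr_ge0// ltW.
have v0v1 : v0 <= v1 by rewrite /v1; lra.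
have v1_gt0 : 0 < v1 by rewrite /v1; lra.
have Psi_v0 : 0 < Psi v0 by rewrite subr_gt0.
have Psi_v1 : Psi v1 <= 0.
  rewrite subr_le0 (le_trans _ (D_ge1 _ v0v1))// -(ler_pM2l v1_gt0) mulr1.
  have := AW _ (mulr_gt0 v1_gt0 (r_gt0 _ v0v1)).
  move=> /(ler_wpM2l (ltW K20)); rewrite /v1; lra.
have cr v : v0 <= v -> {for v, continuous r}.
  move=> v0v; apply: continuousD.
    apply: continuousM; first exact: cst_continuous.
    apply: continuousD; first exact: cst_continuous.
    by apply: continuousM; [exact: cst_continuous|exact: cC].
  by apply: continuousM; [exact: cst_continuous|exact: cB].
have cPsi : {within `[v0, v1], continuous Psi}.
  apply: continuous_in_subspaceT => v; rewrite inE/= in_itv/= => /andP[v0v _].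
  have cvr : {for v, continuous (fun v : R => v * r v)}.
    by apply: continuousM; [exact: cvg_id|exact: cr].
  have cAr := continuous_comp cvr (cA _ v0v).
  have cK (c : R) : {for v, continuous (cst c : R -> R)} by exact: cst_continuous.
  have := continuousB (continuousM (continuousM (cK K2) (cr _ v0v)) cAr)
    (continuousD (cK 1) (continuousM (cK K2) (cC _ v0v))).
  exact.
have [|v] := @IVT R Psi v0 v1 0 v0v1 cPsi.
  by rewrite ge_min Psi_v1 orbT le_max (ltW Psi_v0).
rewrite in_itv/= => /andP[v0v _] Psi_v.
(* [Psi] is strictly positive at [v0], so the zero lies beyond it and is positive even when
   [v0 = 0]. *)
have v0_lt : v0 < v.
  by rewrite lt_neqAle v0v andbT; apply: contraTneq Psi_v0 => ->; rewrite Psi_v ltxx.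
have v_gt0 := le_lt_trans v0_ge0 v0_lt.
have eqD : K2 * r v * A (v * r v) = 1 + K2 * C v.
  by apply/eqP; rewrite -subr_eq0; apply/eqP.
exists (v * r v), v; split => //; first by rewrite mulr_gt0// r_gt0.
  have -> : (K1 - K2) * (v * r v) * A (v * r v) =
     (K1 - K2) / K2 * v * (K2 * r v * A (v * r v)).
    by field; rewrite gt_eqF.
  by rewrite eqD {1}/r; ring.
have -> : K2 * (v * r v) * A (v * r v) = v * (K2 * r v * A (v * r v)) by ring.
by rewrite eqD; ring.
Qed.

Lemma wsum_le_half {R : realType} N (b : R) (x l : 'I_N -> R) (w : R) :
  0 < b -> (forall k, 0 <= l k) -> wsum b%:E x l w <= b / 2 * \sum_k l k.
Proof.
move=> b0 l0; rewrite mulr_sumr ler_sum// => k _; rewrite ler_wpM2r//.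
by rewrite -[leRHS]fbeta0 fbeta_antitone// sqrtr_ge0.
Qed.

Lemma wsum_ge_term {R : realType} N (beta : \bar R) (x l : 'I_N -> R) (w : R) k :
  (0 < beta)%E -> (forall j, 0 <= l j) ->
  fbeta beta (Num.sqrt (w ^+ 2 + x k ^+ 2)) * l k <= wsum beta x l w.
Proof.
move=> b0 l0; rewrite /wsum (bigD1 k)// lerDl sumr_ge0// => j _.
by rewrite mulr_ge0// fbeta_ge0// sqrtr_ge0.
Qed.

Theorem theorem2p3 (R : realType) (a b K1 K2 : R) (N : nat)
    (I I' : 'I_N -> R * R)
    (ha : 0 < a) (hab : a < b) (hK2 : 0 < K2) (hK : K2 < K1)
    (hI : is_partition I `[0, a]) (hI' : is_partition I' `[a, b]) :
  exists betac : R, 0 < betac /\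
    (forall beta : \bar R, (betac%:E < beta)%E ->
       exists u v : R, [/\ 0 < u, 0 < v & max_mixed K1 K2 I I' beta u v]) /\
    (forall beta : R, 0 < beta -> beta < betac ->
       forall u v : R,
         max_mixed K1 K2 I I' beta%:E u v <-> u = 0 /\ v = 0).
Proof.
pose xl k := (I k).1; pose w k := len (I k).
pose yl k := (I' k).1; pose yr k := (I' k).2; pose w' k := len (I' k).
have lt12 k : (I k).1 < (I k).2 by have [] := is_partition_bounds _ _ _ _ k hI.
have lt12' k : (I' k).1 < (I' k).2 by have [] := is_partition_bounds _ _ _ _ k hI'.
have xl0 k : 0 <= xl k by have [] := is_partition_bounds _ _ _ _ k hI.
have xla k : xl k <= a.
  by have [_ /ltW h1 h2] := is_partition_bounds _ _ _ _ k hI; exact: le_trans h2.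
have yla k : a <= yl k by have [] := is_partition_bounds _ _ _ _ k hI'.
have yl0 k : 0 <= yl k by rewrite (le_trans (ltW ha)).
have ylr k : yl k <= yr k by exact: ltW (lt12' k).
have yr0 k : 0 <= yr k by rewrite (le_trans (yl0 k)).
have w_gt0 k : 0 < w k by rewrite subr_gt0 lt12.
have w'_gt0 k : 0 < w' k by rewrite subr_gt0 lt12'.
have w0 k : 0 <= w k by exact: ltW.
have w'0 k : 0 <= w' k by exact: ltW.
have xlyr j k : xl j <= yr k by rewrite (le_trans (xla j))// (le_trans (yla k)).
have [k0 xlk0] : exists k, xl k = 0 := is_partition_left _ _ _ _ (ltW ha) hI.
pose W := \sum_k w k; pose W' := \sum_k w' k.
have W0 : 0 <= W by exact: sumr_ge0.
have W'0 : 0 <= W' by exact: sumr_ge0.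
have K120 : 0 < K1 - K2 by rewrite subr_gt0.
pose A beta u := wsum beta xl w u.
pose B beta v := wsum beta yl w' v.
pose C beta v := wsum beta yr w' v.
have A0 beta u : (0 < beta)%E -> 0 <= A beta u by move=> ?; exact: wsum_ge0.
have B0 beta u : (0 < beta)%E -> 0 <= B beta u by move=> ?; exact: wsum_ge0.
have C0 beta u : (0 < beta)%E -> 0 <= C beta u by move=> ?; exact: wsum_ge0.
have mixedE beta u v : (0 < beta)%E -> (beta = +oo%E -> 0 < u /\ 0 < v) ->
    max_mixed K1 K2 I I' beta u v <->
    u = (K1 - K2) * u * A beta u + K2 * v * B beta v /\
    v + K2 * v * C beta v = K2 * u * A beta u.
  by move=> beta0 uv0; rewrite /max_mixed !maxsumE ?minsumE// => /uv0[].
pose sup (beta : R) := supercritical K1 K2 (A beta%:E 0) (B beta%:E 0) (C beta%:E 0).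
have sup_homo beta beta' : 0 < beta -> beta <= beta' -> sup beta -> sup beta'.
  move=> beta0 le; have beta'0 := lt_le_trans beta0 le.
  apply: supercritical_homo => //; rewrite ?A0 ?B0 ?C0//.
  - exact: wsum_homo_beta.
  - exact: wsum_homo_beta.
  - exact: wsum_cross_beta.
have solvable beta v0 : (0 < beta)%E -> 0 <= v0 -> (beta = +oo%E -> 0 < v0) ->
    (let r := (K1 - K2) / K2 * (1 + K2 * C beta v0) + K2 * B beta v0 in
     1 + K2 * C beta v0 < K2 * r * A beta (v0 * r)) ->
    exists u v : R, [/\ 0 < u, 0 < v & max_mixed K1 K2 I I' beta u v].
  move=> beta0 v0_ge0 v0_gt0 gap.
  have pos v : v0 <= v -> beta = +oo%E -> 0 < v.
    by move=> v0v /v0_gt0 /lt_le_trans; apply.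
  have [] // := @exists_positive_solution R K1 K2 W v0 (A beta) (B beta) (C beta).
  - by move=> v _; exact: B0.
  - by move=> v _; exact: C0.
  - by move=> u u0; exact: mul_wsum_le.
  - by move=> v v0v; apply: continuous_wsum => //; exact: pos.
  - by move=> v v0v; apply: continuous_wsum => //; exact: pos.
  - move=> v v0v; apply: continuous_wsum => // /pos -/(_ _ v0v) v_gt0.
    rewrite mulr_gt0// ltr_wpDr ?mulr_ge0 ?B0 ?(ltW hK2)//.
    by rewrite mulr_gt0 ?divr_gt0// ltr_pwDl// mulr_ge0 ?C0// ltW.
  move=> u [v [u0 v_gt0 equ eqv]]; exists u, v; split => //.
  by apply/mixedE.
(* The critical number is [inf S]; [sup_homo] makes [S] upward closed among the reals. *)
pose S := [set beta : R | 0 < beta /\ sup beta].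
pose X := W * (K1 - K2); pose Y := K2 ^+ 2 * (W * W').
have X0 : 0 <= X by rewrite mulr_ge0// ltW.
have Y0 : 0 <= Y by rewrite !mulr_ge0// ltW.
(* For [beta < e] the bounds [A <= beta / 2 * W] and [B <= beta / 2 * W'] keep both parts of the
   criterion at most [1 / 2], relative to [D >= 1]; hence [inf S] is positive. *)
pose e := (1 + X + Y)^-1.
have e0 : 0 < e by rewrite invr_gt0; lra.
have lbS : lbound S e.
  move=> beta [beta0 supb]; rewrite leNgt; apply/negP => ltb.
  have : beta * (1 + X + Y) < 1 by rewrite -ltr_pdivlMr ?mul1r//; lra.
  have := mulr_ge0 (ltW beta0) X0; have := mulr_ge0 (ltW beta0) Y0.
  rewrite !mulrDr mulr1 => bY0 bX0 b1.
  have Ab := wsum_le_half _ _ xl w 0 beta0 w0.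
  have Bb := wsum_le_half _ _ yl w' 0 beta0 w'0.
  have AK : A beta%:E 0 * (K1 - K2) <= 1 / 2.
    apply: le_trans (ler_wpM2r (ltW K120) Ab) _.
    rewrite (_ : _ * _ = beta * X / 2); last by rewrite /X /W; ring.
    by lra.
  have AB : K2 ^+ 2 * (A beta%:E 0 * B beta%:E 0) <= 1 / 2.
    have := ler_pM (A0 beta%:E 0 beta0) (B0 beta%:E 0 beta0) Ab Bb.
    move=> /(ler_wpM2l (sqr_ge0 K2)) /le_trans; apply.
    rewrite -/W -/W' (_ : _ * _ = beta / 4 * (beta * Y)); last by rewrite /Y; field.
    by have : beta * (beta * Y) <= 1 * 1; [apply: ler_pM => //; lra|lra].
  move: supb; rewrite /sup /supercritical.
  set D := 1 + K2 * _; have D1 : 1 <= D by rewrite lerDl mulr_ge0 ?C0// ltW.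
  have := ler_wpM2r (le_trans ler01 D1) AK.
  lra.
have S0 : S !=set0.
  (* The cell [k0], sampled at [0], contributes [beta / 2 * w k0] to [A]; this choice makes
     [A * (K1 - K2) >= 2]. *)
  pose beta := 4 / (w k0 * (K1 - K2)).
  have beta0 : 0 < beta by rewrite divr_gt0// mulr_gt0.
  exists beta; split=> //; rewrite /sup /supercritical.
  have := wsum_ge_term _ _ xl w 0 k0 (beta0 : (0 < beta%:E)%E) w0.
  rewrite xlk0 sqrt_sqr0D// fbeta0 => /(ler_wpM2r (ltW K120)).
  rewrite (_ : beta / 2 * w k0 * (K1 - K2) = 2); last first.
    by rewrite /beta; field; rewrite !gt_eqF.
  set D := 1 + K2 * _; have D1 : 1 <= D by rewrite lerDl mulr_ge0 ?C0// ltW.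
  move=> /(ler_wpM2r (le_trans ler01 D1)).
  have : 0 <= A beta%:E 0 * (K2 ^+ 2 * B beta%:E 0).
    by rewrite !mulr_ge0 ?A0 ?B0 ?(ltW hK2).
  rewrite /A; lra.
have infS : has_inf S by split => //; exists e.
exists (inf S); split; first by rewrite (lt_le_trans e0)// lb_le_inf.
split.
  move=> [beta| |]// lt; last first.
    (* At [beta = +oo] the search starts from a positive [v0]. [M] bounds [C] because the right
       endpoints are at least [a]; the cell [k0] alone gives [K2 * r * A >= K2 * w k0 / v0], and
       [v0] is chosen to make this [2 * (1 + K2 * M)]. *)
    pose M := a^-1 * W'.
    have M0 : 0 <= M by rewrite mulr_ge0// invr_ge0 ltW.
    have M1 : 0 < 1 + K2 * M by rewrite ltr_pwDl// mulr_ge0// ltW.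
    pose v0 := K2 * w k0 / (2 * (1 + K2 * M)).
    have v0_gt0 : 0 < v0 by rewrite divr_gt0 ?mulr_gt0.
    apply: (solvable _ v0) => //=; first exact: ltW.
    set r := (X in v0 * X).
    have r0 : 0 < r.
      rewrite ltr_wpDr ?mulr_ge0 ?B0 ?(ltW hK2)//.
      by rewrite mulr_gt0 ?divr_gt0// ltr_pwDl// mulr_ge0 ?C0// ltW.
    have CM : C +oo%E v0 <= M.
      rewrite /M /W' mulr_sumr ler_sum// => k _; rewrite ler_wpM2r//= lef_pV2 ?posrE//.
        rewrite -[leLHS]gtr0_norm// -sqrtr_sqr ler_wsqrtr//.
        rewrite ler_wpDl ?sqr_ge0// lerXn2r ?nnegrE ?(ltW ha)//.
        by rewrite (le_trans (yla k)).
      by rewrite sqrtr_gt0 ltr_pwDl ?sqr_ge0// exprn_gt0.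
    have v0r0 : 0 < v0 * r by rewrite mulr_gt0.
    have Ar : (v0 * r)^-1 * w k0 <= A +oo%E (v0 * r).
      apply: le_trans (wsum_ge_term _ _ xl w (v0 * r) k0 _ w0) => //.
      by rewrite xlk0 expr0n addr0 sqrtr_sqr gtr0_norm.
    apply: (@lt_le_trans _ _ (K2 * r * ((v0 * r)^-1 * w k0))); last first.
      by rewrite ler_wpM2l// mulr_ge0// ltW.
    rewrite (_ : _ * (_ * w k0) = 2 * (1 + K2 * M)); last first.
      by rewrite /v0; field; rewrite !gt_eqF.
    by have := ler_wpM2l (ltW hK2) CM; lra.
  have [|beta' [beta'0 supb'] lt'] := @inf_adherent _ S (beta - inf S) _ infS.
    by rewrite subr_gt0.
  rewrite addrC subrK in lt'.
  have supb := sup_homo _ _ beta'0 (ltW lt') supb'.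
  have beta0 := lt_trans beta'0 lt'.
  (* At [v0 = 0] the starting inequality is the criterion itself, [K2 * r] being
     [(K1 - K2) * (1 + K2 * C) + K2 ^+ 2 * B]. *)
  apply: (solvable _ 0) => //=.
  rewrite mul0r; move: supb; rewrite /sup /supercritical.
  congr (_ < _); field; exact: lt0r_neq0.
move=> beta beta0 lt u v.
rewrite mixedE//; split; last by move=> [-> ->]; rewrite !(mulr0, mul0r, addr0).
move=> [equ eqv].
apply: (@trivial_of_not_supercritical R K1 K2 (A beta%:E u) (B beta%:E v)
  (C beta%:E v) (A beta%:E 0) (B beta%:E 0) (C beta%:E 0) u v) => //;
  rewrite ?A0 ?B0 ?C0//.
- by move=> u0; apply: wsum_lt_at0 xlk0 u0.
- exact: wsum_le_at0.
- exact: wsum_le_at0.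
- exact: wsum_drop_le.
- exact: wsum_cross.
- move=> supb; have : inf S <= beta by apply: ge_inf => //; exists e.
  by rewrite leNgt lt.
Qed.
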